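(* Let $\mathfrak g$ be a $2n$-dimensional unimodular real Lie algebra and let $(J,F)$ be a Hermitian structure on $\mathfrak g$. Let $$\Gamma=\{\eta\in\textstyle\bigwedge^2\mathfrak g^*\mid J\eta=\eta\ \text{and}\ F^{n-1}\wedge\eta=0\}.$$ Then $(J,F)$ is abelian balanced if and only if the image of $d:\mathfrak g^*\to\bigwedge^2\mathfrak g^*$ is contained in $\Gamma$.
   Context: $\mathfrak g$ is unimodular if $\operatorname{tr}\operatorname{ad}_X=0$ for all $X$. $d$ is the Chevalley-Eilenberg differential: $d\alpha(X,Y)=-\alpha([X,Y])$ for $\alpha\in\mathfrak g^*$. For a $2$-form, $(J\eta)(X,Y)=\eta(JX,JY)$. A complex structure on $\mathfrak g$ is a linear map $J$ with $J^2=-\mathrm{Id}$ and $[JX,JY]-J[JX,Y]-J[X,JY]-[X,Y]=0$; it is abelian if $[JX,JY]=[X,Y]$ for all $X,Y$. A Hermitian structure is a pair $(J,g)$ with $J$ a complex structure and $g$ an inner product with $g(JX,JY)=g(X,Y)$, equivalently denoted $(J,F)$ with $F(X,Y)=g(X,JY)$; it is balanced if $d(F^{n-1})=0$ (equivalently $d^*F=0$), and abelian balanced if $J$ is abelian and $F$ is balanced. *)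

(* Defs.v *)
From HB Require Import structures.
From mathcomp Require Import all_boot all_order all_algebra all_fingroup.
From mathcomp Require Import all_classical reals.

Set Implicit Arguments.
Unset Strict Implicit.
Unset Printing Implicit Defensive.

Import Order.TTheory GRing.Theory Num.Theory.

Local Open Scope ring_scope.
Local Open Scope classical_set_scope.

Section Forms.
Variables (R : fieldType) (V : vectType R).

Definition update k (X : 'I_k -> V) (i : 'I_k) (u : V) : 'I_k -> V :=
  fun j => if j == i then u else X j.

(* A k-form is a function of k vectors; membership in the k-th exterior power
   of the dual, i.e. being multilinear and alternating, is [ext_power V k]. *)
Definition cochain k : Type := ('I_k -> V) -> R.

Definition multilinear k (w : cochain k) : Prop :=
  forall (X : 'I_k -> V) (i : 'I_k) (a : R) (u v : V),
    w (update X i (a *: u + v)) = a * w (update X i u) + w (update X i v).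

Definition alternating k (w : cochain k) : Prop :=
  forall (X : 'I_k -> V) (i j : 'I_k), i != j -> X i = X j -> w X = 0.

Definition ext_power k : set (cochain k) :=
  [set w | multilinear w /\ alternating w].

(* Normalized so that (a /\ b)(X, Y) = a(X) b(Y) - a(Y) b(X) for 1-forms. *)
Definition wedge p q (a : cochain p) (b : cochain q) : cochain (p + q) :=
  fun X => ((p`! * q`!)%:R)^-1 *
    \sum_(s : 'S_(p + q)) (-1) ^+ s *
      a (fun i => X (s (lshift q i))) * b (fun j => X (s (rshift p j))).

(* The k-th wedge power of a 2-form; k.+1.*2 is convertible to 2 + k.*2. *)
Fixpoint wedge_pow (F : cochain 2) k : cochain k.*2 :=
  if k is k'.+1 then wedge F (@wedge_pow F k') else fun=> 1.

Definition pullback (J : V -> V) k (w : cochain k) : cochain k :=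
  fun X => w (J \o X).

(* The usual formula
     (dw)(X_0, .., X_k) = \sum_(i < j) (-1)^(i+j) w([X_i, X_j], .. ^i .. ^j ..),
   except that [X_i, X_j] is put in the slot of X_i rather than in front, which
   on alternating w costs a sign (-1)^i.  For i < j, lift j i has value i. *)
Definition ce_diff (br : V -> V -> V) k (w : cochain k) : cochain k.+1 :=
  fun X => \sum_(j < k.+1) \sum_(i < k | (i < j)%N)
    (-1) ^+ j * w (update (X \o lift j) i (br (X (lift j i)) (X j))).

Lemma ce_diff1E (br : V -> V -> V) (w : cochain 1) (X : 'I_2 -> V) :
  ce_diff br w X = - w (fun=> br (X ord0) (X ord_max)).
Proof.
rewrite /ce_diff big_ord_recl big_pred0; last by move=> i; rewrite ltn0.
rewrite big_ord1 add0r big_mkcond big_ord1 /= expr1 mulN1r; congr (- w _).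
apply/funext => l; rewrite /update !ord1 eqxx.
by congr (br (X _) (X _)); apply/val_inj.
Qed.

Record is_lie_bracket (br : {bilinear V -> V -> V}) : Prop := IsLieBracket {
  lie_bracket_alt : forall x, br x x = 0;
  lie_bracket_jacobi : forall x y z,
    br x (br y z) + br y (br z x) + br z (br x y) = 0
}.

Definition lfun_trace (f : 'End(V)) : R :=
  \tr (passmx.mxof (vbasis fullv) (vbasis fullv) f).

Definition unimodular (br : {bilinear V -> V -> V}) : Prop :=
  forall x, lfun_trace (linfun (br x)) = 0.

Record is_complex_structure (br : V -> V -> V) (J : V -> V) : Prop :=
  IsComplexStructure {
  complex_structure_sqr : forall x, J (J x) = - x;
  complex_structure_integrable : forall x y,
    br (J x) (J y) - J (br (J x) y) - J (br x (J y)) - br x y = 0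
}.

Definition is_abelian (br : V -> V -> V) (J : V -> V) : Prop :=
  forall x y, br (J x) (J y) = br x y.

End Forms.

Arguments ext_power {R} V k _.
Arguments wedge_pow {R V} F k _.

Section Hermitian.
Variables (R : realType) (V : vectType R).

Record is_hermitian_structure (br : V -> V -> V) (J : {linear V -> V})
    (g : {dot V for idfun}) : Prop := IsHermitianStructure {
  hermitian_complex : is_complex_structure br J;
  hermitian_compatible : forall x y, g (J x) (J y) = g x y
}.

Definition fundamental_form (J : {linear V -> V}) (g : {dot V for idfun}) :
  cochain V 2 := fun X => g (X ord0) (J (X ord_max)).

Definition is_balanced (br : V -> V -> V) (n : nat) (F : cochain V 2) : Prop :=
  ce_diff br (wedge_pow F n.-1) = 0.

Definition is_abelian_balanced (br : V -> V -> V) (n : nat)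
    (J : {linear V -> V}) (g : {dot V for idfun}) : Prop :=
  is_abelian br J /\ is_balanced br n (fundamental_form J g).

Definition Gamma (n : nat) (J : {linear V -> V}) (g : {dot V for idfun}) :
  set (cochain V 2) :=
  [set eta | [/\ ext_power V 2 eta, pullback J eta = eta &
    wedge (wedge_pow (fundamental_form J g) n.-1) eta = 0]].

End Hermitian.

(* Main.v *)
Require Import Defs.
From mathcomp Require Import all_boot all_order all_algebra all_fingroup.
From mathcomp Require Import all_classical reals.

(** Being abelian is the same as J (d alpha) = d alpha for all 1-forms alpha,
    since d alpha (X, Y) = - alpha [X, Y] and 1-forms separate vectors
    ([abelian_iff_pullback]).  What remains is to show that w = F^(n-1) is
    closed if and only if w /\ d alpha = 0 for every 1-form alpha.

    For n > 0 this holds for any alternating form w of degree 2n - 2, and the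
    reason is the Leibniz rule d(alpha /\ w) = d alpha /\ w - alpha /\ dw
    ([leibniz]).  The form alpha /\ w has degree 2n - 1, and on a unimodular Lie
    algebra the differential of such a form vanishes, because its coefficients
    are traces of adjoint maps ([ce_diff_codim1]).  Hence
    w /\ d alpha = alpha /\ dw for all alpha, and dw, of degree 2n - 1, is zero
    as soon as all its products with 1-forms are ([closed_iff_wedge_exact0]).

    Signs are kept under control by working with permutations rather than with
    increasing indices.  The expression [omit w X q], which is (-1)^q times w on
    X without its q-th vector, satisfies
    omit w (X o s) q = sgn(s) omit w X (s q).  The differential then becomes half
    of a sum of [bracket_term] over ordered pairs p != q, and the wedge product
    with a 2-form half of a similar sum over twofold deletions ([wedge2_sum]), so
    that the Leibniz rule amounts to comparing sums over triples of indices.  The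
    sums are evaluated on bases only: an alternating form vanishes on dependent
    vectors ([ext_power_dependent]). *)

Set Implicit Arguments.
Unset Strict Implicit.
Unset Printing Implicit Defensive.

Import Order.TTheory GRing.Theory Num.Theory.

Local Open Scope ring_scope.
Local Open Scope classical_set_scope.

(** * Replacing one vector of a tuple *)

Section Update.
Variables (R : fieldType) (V : vectType R) (k : nat).
Implicit Types (X : 'I_k -> V) (u v : V).

Lemma update_same X i u : update X i u i = u.
Proof. by rewrite /update eqxx. Qed.

Lemma update_neq X i j u : j != i -> update X i u j = X j.
Proof. by rewrite /update => /negbTE->. Qed.

Lemma update_id X i : update X i (X i) = X.
Proof. by apply/funext => j; rewrite /update; case: eqP => [->|]. Qed.

Lemma updateU X i u v : update (update X i u) i v = update X i v.
Proof. by apply/funext => j; rewrite /update; case: eqP. Qed.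

Lemma updateC X i j u v : i != j ->
  update (update X i u) j v = update (update X j v) i u.
Proof.
move=> nij; apply/funext => l; rewrite /update.
by case: (eqVneq l j) => [->|//]; rewrite eq_sym (negbTE nij).
Qed.

Lemma update_comp m (f : 'I_m -> 'I_k) X i u : injective f ->
  update X (f i) u \o f = update (X \o f) i u.
Proof. by move=> fI; apply/funext => j; rewrite /update /= (inj_eq fI). Qed.

Lemma update_comp_notin m (f : 'I_m -> 'I_k) X p u :
  (forall i, f i != p) -> update X p u \o f = X \o f.
Proof. by move=> fp; apply/funext => i; rewrite /= update_neq. Qed.

End Update.

(** * Alternating forms *)

Section Antisymmetric.
Variables (R : numFieldType) (V : vectType R) (k : nat).
Implicit Types (X : 'I_k -> V) (w : cochain V k).

(** The sign rule under arbitrary permutations.  For multilinear forms in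
    characteristic 0 it is equivalent to alternation, and it is the version
    in which alternation passes easily through sums over permutations. *)
Definition antisymmetric_form w : Prop :=
  forall (s : 'S_k) X, w (X \o s) = (-1) ^+ s * w X.

Lemma multilinear0 w X i : multilinear w -> w (update X i 0) = 0.
Proof.
by move=> /(_ X i 1 0 0); rewrite scale1r addr0 mul1r => /eqP; rewrite -subr_eq0
   opprD addNKr oppr_eq0 => /eqP.
Qed.

Lemma multilinearD w X i u v : multilinear w ->
  w (update X i (u + v)) = w (update X i u) + w (update X i v).
Proof. by move=> /(_ X i 1 u v); rewrite scale1r mul1r. Qed.

Lemma multilinear_sum w X i (I : finType) (c : I -> R) (v : I -> V) :
  multilinear w ->
  w (update X i (\sum_j c j *: v j)) = \sum_j c j * w (update X i (v j)).
Proof.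
move=> wL; pose G (x : V) (y : R) := w (update X i x) = y.
apply: (big_ind2 G) => [|x1 x2 y1 y2 <- <-|j _]; first exact: multilinear0.
  exact: multilinearD.
by rewrite /G -[c j *: v j]addr0 wL multilinear0// addr0.
Qed.

(** Permutations are products of transpositions, and for a transposition
    of i and j the rule is the polarization of w(.., x, .., x, ..) = 0 at
    x = X i + X j. *)
Lemma ext_power_antisymmetric w : ext_power V k w -> antisymmetric_form w.
Proof.
move=> [wL wA] s; have [ts -> _] := prod_tpermP s.
elim: ts => [|[i j] ts IH] X /=.
  rewrite big_nil odd_perm1 mul1r; congr w.
  by apply/funext => l; rewrite /= perm1.
rewrite big_cons odd_permM signr_addb /=.
have -> : X \o (tperm i j * \prod_(t <- ts) tperm t.1 t.2)%g =
   (X \o (\prod_(t <- ts) tperm t.1 t.2)%g) \o tperm i j.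
  by apply/funext => l; rewrite /= permM.
rewrite -mulrA -{}IH; move: (X \o _) => {}X; rewrite odd_tperm.
have [->|nij] := eqVneq i j.
  by rewrite tperm1 mul1r; congr w; apply/funext => l; rewrite /= perm1.
rewrite expr1 mulN1r; apply/eqP; rewrite -addr_eq0; apply/eqP.
pose f u v := w (update (update X i u) j v).
have fuu u : f u u = 0.
  by apply: (wA _ i j nij); rewrite update_same update_neq// update_same.
have := fuu (X i + X j); rewrite {1}/f multilinearD// updateC//.
rewrite [update (update X i _) j (X j)]updateC// !multilinearD//.
rewrite -!(updateC _ _ _ nij) -/(f _ _) -/(f _ _) -/(f _ _) -/(f _ _).
have -> : X \o tperm i j = update (update X i (X j)) j (X i).
  apply/funext => l /=; case: tpermP => [->|->|/eqP nli /eqP nlj].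
  - by rewrite update_neq// update_same.
  - by rewrite update_same.
  - by rewrite !update_neq.
have <- : f (X i) (X j) = w X by rewrite /f !update_id.
by rewrite -/(f _ _) -/(f _ _) !fuu add0r addr0 addrC.
Qed.

(** Swapping two equal arguments gives w X = - w X. *)
Lemma antisymmetric_alternating w : antisymmetric_form w -> alternating w.
Proof.
move=> wS X i j nij Xij.
have : w X = - w X.
  have := wS (tperm i j) X; rewrite odd_tperm nij expr1 mulN1r => <-.
  congr w; apply/funext => l /=.
  by case: tpermP => [->|->|].
by move=> /eqP; rewrite -addr_eq0 -mulr2n mulrn_eq0 => /eqP.
Qed.

Lemma antisymmetric_ext_power w :
  multilinear w -> antisymmetric_form w -> ext_power V k w.
Proof. by move=> wL /antisymmetric_alternating. Qed.

(** In a linear relation between the X j whose coefficient at X i is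
    nonzero, substitute the relation into slot i: every term but the i-th
    has a repeated argument.  This is what allows an identity between
    top-degree forms to be checked on bases only. *)
Lemma ext_power_dependent w X :
  ext_power V k w -> ~~ free [tuple X i | i < k] -> w X = 0.
Proof.
move=> [wL wA] /freeP dep.
have [c [c0 [i ci]]] : exists c : 'I_k -> R,
    \sum_j c j *: X j = 0 /\ exists i, c i != 0.
  apply: contra_notP dep => h c c0 i; apply/eqP; apply: contra_notT h => ci.
  exists c; split; last by exists i.
  by rewrite -[RHS]c0; apply: eq_bigr => j _; rewrite -tnth_nth tnth_mktuple.
have := multilinear0 X i wL.
rewrite -c0 multilinear_sum// (bigD1 i)//= update_id big1 => [/eqP|j nji].
  by rewrite addr0 mulf_eq0 (negbTE ci) => /eqP.
by rewrite (wA _ _ _ nji) ?mulr0// update_same update_neq.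
Qed.

Lemma ext_power_gt_dim w :
  (\dim {:V} < k)%N -> ext_power V k w -> w = 0.
Proof.
move=> dimV wE; apply/funext => X; apply: (ext_power_dependent wE).
apply: contraL dimV; rewrite -leqNgt => /eqP XE.
by have := dimvS (subvf <<[tuple X i | i < k]>>); rewrite XE size_tuple.
Qed.

End Antisymmetric.

Section OneForms.
Variables (R : numFieldType) (V : vectType R).

Lemma cochain1P (alpha : cochain V 1) a u v : multilinear alpha ->
  alpha (fun=> a *: u + v) = a * alpha (fun=> u) + alpha (fun=> v).
Proof.
have cst x : (fun=> x) = update (fun=> 0) ord0 x :> ('I_1 -> V).
  by apply/funext => l; rewrite /update !ord1 eqxx.
by move=> aL; rewrite (cst (_ + _)) aL -!cst.
Qed.

Lemma cochain1N (alpha : cochain V 1) u :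
  multilinear alpha -> alpha (fun=> - u) = - alpha (fun=> u).
Proof.
move=> aL; have := cochain1P (-1) u u aL; rewrite scaleN1r addNr mulN1r addNr.
have := cochain1P (-1) u 0 aL; rewrite scaleN1r addr0 mulN1r => -> ->.
by rewrite addr0.
Qed.

Lemma linear_ext_power (phi : {linear V -> R^o}) :
  ext_power V 1 (fun X => phi (X ord0)).
Proof.
split=> [X i a u v|X i j]; last by rewrite !ord1 eqxx.
by rewrite !ord1 /update !eqxx linearP.
Qed.

Lemma ext_power1_separates (x : V) :
  (forall alpha, ext_power V 1 alpha -> alpha (fun=> x) = 0) -> x = 0.
Proof.
move=> x0; rewrite (coord_vbasis (memvf x)) big1// => i _.
have := x0 _ (linear_ext_power (coord (vbasis fullv) i)).
by rewrite /= => ->; rewrite scale0r.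
Qed.

End OneForms.

(** * Wedge products and wedge powers *)

Section Wedge.
Variables (R : numFieldType) (V : vectType R).

(** The wedge product sums over all permutations, so whatever a and b are,
    permuting the arguments only reindexes the sum. *)
Lemma wedge_antisymmetric p q (a : cochain V p) (b : cochain V q) :
  antisymmetric_form (wedge a b).
Proof.
move=> t X; rewrite /wedge mulrCA; congr (_ * _).
rewrite [in RHS](reindex_inj (mulIg t)) big_distrr; apply: eq_bigr => s _ /=.
rewrite !mulrA -signr_addb odd_permM addbCA addbb addbF.
by congr (_ * a _ * b _); apply/funext => i; rewrite /= permM.
Qed.

(** In each summand the slot i is fed to exactly one of the two factors. *)
Lemma wedge_multilinear p q (a : cochain V p) (b : cochain V q) :
  multilinear a -> multilinear b -> multilinear (wedge a b).
Proof.
move=> aL bL X i c u v; rewrite /wedge [X in _ = X + _]mulrCA -mulrDr.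
congr (_ * _); rewrite big_distrr -big_split/=.
apply: eq_bigr => s _.
have updl j x : s (lshift q j) = i ->
    (fun l => update X i x (s (lshift q l))) =
    update (fun l => X (s (lshift q l))) j x.
  move=> <-; apply: (update_comp X j x) => l l' /perm_inj; exact: lshift_inj.
have updr j x : s (rshift p j) = i ->
    (fun l => update X i x (s (rshift p l))) =
    update (fun l => X (s (rshift p l))) j x.
  move=> <-; apply: (update_comp X j x) => l l' /perm_inj; exact: rshift_inj.
(* Whether s^-1 i is a left or a right index tells which factor sees
   slot i. *)
have : exists j, s j = i by exists (s^-1 i)%g; rewrite permKV.
move=> [j]; rewrite -(splitK j); case: (fintype.split j) => {}j /= sj.
  have fixr x : (fun l => update X i x (s (rshift p l))) =
      (fun l => X (s (rshift p l))).
    apply: update_comp_notin => l; rewrite -sj (inj_eq perm_inj).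
    by rewrite eq_sym eq_lrshift.
  by rewrite !fixr !(updl j _ sj) aL mulrDr mulrDl !mulrA [_ * c]mulrC.
have fixl x : (fun l => update X i x (s (lshift q l))) =
    (fun l => X (s (lshift q l))).
  apply: update_comp_notin => l; rewrite -sj (inj_eq perm_inj).
  by rewrite eq_lrshift.
by rewrite !fixl !(updr j _ sj) bL mulrDr !mulrA [_ * c]mulrC !mulrA.
Qed.

Lemma wedge_ext_power p q (a : cochain V p) (b : cochain V q) :
  multilinear a -> multilinear b -> ext_power V (p + q) (wedge a b).
Proof.
move=> aL bL; apply: antisymmetric_ext_power; last exact: wedge_antisymmetric.
exact: wedge_multilinear.
Qed.

Lemma wedge_pow_ext_power (F : cochain V 2) k :
  multilinear F -> ext_power V k.*2 (wedge_pow F k).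
Proof.
move=> FL; elim: k => [|k [IH _]]; first by split=> [X []|X []].
exact: (wedge_ext_power FL IH).
Qed.

End Wedge.

(** * Deleting one or two arguments *)

Lemma sum_lift (M : nmodType) k (q : 'I_k.+1) (F : 'I_k.+1 -> M) :
  \sum_(p | p != q) F p = \sum_(i < k) F (lift q i).
Proof.
rewrite (reindex_omap (lift q) (unlift q)) => [|p npq].
  by apply: eq_bigl => i; rewrite liftK eqxx andbT eq_sym neq_lift.
by case: unliftP npq => [i ->//|->]; rewrite eqxx.
Qed.

(** A permutation of k.+1 points is its value at q together with a
    permutation of the remaining k points. *)
Lemma perm_fix_lift k (s : 'S_k.+1) q : exists t : 'S_k, s = lift_perm q (s q) t.
Proof.
have [t tE] : exists t : 'S_k, lift_perm q (s q) t = s; last by exists t.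
pose f i := odflt i (unlift (s q) (s (lift q i))).
have fE i : lift (s q) (f i) = s (lift q i).
  rewrite /f; case: (unliftP (s q) (s (lift q i))) => //= /perm_inj/eqP.
  by rewrite eq_sym (negbTE (neq_lift _ _)).
have fI : injective f.
  move=> i j fij; have := fE i; rewrite fij fE => /perm_inj/lift_inj.
  by [].
exists (perm fI); apply/permP => i; case: (unliftP q i) => [i' ->|->].
  by rewrite lift_perm_lift permE fE.
by rewrite lift_perm_id.
Qed.

Lemma sign_fix_lift (R : pzRingType) k (s : 'S_k.+1) q (t : 'S_k) :
  s = lift_perm q (s q) t ->
  (-1) ^+ q * (-1) ^+ t = (-1) ^+ s * (-1) ^+ (s q) :> R.
Proof.
move=> st; rewrite [in RHS]st odd_lift_perm lift_perm_id.
rewrite -[(-1) ^+ q]signr_odd -[(-1) ^+ (s q)]signr_odd -!signr_addb.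
congr ((-1) ^+ nat_of_bool _).
by case: (odd q) (odd (s q)) (odd_perm t) => [] [] [].
Qed.

Section Omit.
Variables (R : numFieldType) (V : vectType R).

(** Deleting an argument with its sign (-1)^q makes every later formula
    equivariant under permutations, with no position-dependent signs left
    over. *)
Definition omit k (w : cochain V k) (X : 'I_k.+1 -> V) (q : 'I_k.+1) : R :=
  (-1) ^+ q * w (X \o lift q).

Lemma omit_ext k (w : cochain V k) X Y q :
  (forall i, i != q -> X i = Y i) -> omit w X q = omit w Y q.
Proof.
move=> XY; congr (_ * w _); apply/funext => i /=.
by apply: XY; rewrite eq_sym neq_lift.
Qed.

Lemma omit_update k (w : cochain V k) X q u :
  omit w (update X q u) q = omit w X q.
Proof. by apply: omit_ext => i niq; rewrite update_neq. Qed.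

Lemma omit_multilinear k (w : cochain V k) X p q a u v :
  multilinear w -> p != q ->
  omit w (update X p (a *: u + v)) q
    = a * omit w (update X p u) q + omit w (update X p v) q.
Proof.
rewrite /omit => wL; case: (unliftP q p) => [i ->|->]; last by rewrite eqxx.
by move=> _; rewrite !(update_comp _ _ _ lift_inj) wL mulrDr mulrCA.
Qed.

Lemma omit_sum k (w : cochain V k) X p q (I : finType)
    (c : I -> R) (v : I -> V) :
  multilinear w -> p != q ->
  omit w (update X p (\sum_j c j *: v j)) q
    = \sum_j c j * omit w (update X p (v j)) q.
Proof.
rewrite /omit => wL; case: (unliftP q p) => [i ->|->]; last by rewrite eqxx.
move=> _; rewrite (update_comp _ _ _ lift_inj) multilinear_sum// big_distrr.
by apply: eq_bigr => j _; rewrite /= (update_comp _ _ _ lift_inj) mulrCA.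
Qed.

Lemma omit_repeat k (w : cochain V k) X i j q :
  alternating w -> i != j -> i != q -> j != q -> X i = X j -> omit w X q = 0.
Proof.
move=> wA nij; case: (unliftP q i) nij => [i' ->|->]; last by rewrite eqxx.
case: (unliftP q j) => [j' ->|->]; last by rewrite eqxx.
rewrite (inj_eq lift_inj) => nij _ _ Xij.
by rewrite /omit (wA _ i' j')// mulr0.
Qed.

(** The parities of q and s q in the sign of the lifted permutation are
    exactly the two signs built into [omit]. *)
Lemma omit_perm k (w : cochain V k) (s : 'S_k.+1) X q :
  antisymmetric_form w -> omit w (X \o s) q = (-1) ^+ s * omit w X (s q).
Proof.
move=> wS; have [t st] := perm_fix_lift s q.
rewrite /omit; have -> : X \o s \o lift q = (X \o lift (s q)) \o t.
  by apply/funext => i; rewrite /= {1}st lift_perm_lift.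
by rewrite wS !mulrA (sign_fix_lift _ st).
Qed.

(** Up to the deleted slot q, the tuple with X q copied into slot p is X
    with p and q exchanged. *)
Lemma omit_transfer k (w : cochain V k) X p q :
  antisymmetric_form w -> p != q ->
  omit w (update X p (X q)) q = - omit w X p.
Proof.
move=> wS npq; rewrite (@omit_ext _ _ _ (X \o tperm p q)).
  by rewrite omit_perm// odd_tperm npq tpermR expr1 mulN1r.
move=> i niq /=; have [->|nip] := eqVneq i p.
  by rewrite tpermL update_same.
by rewrite tpermD ?update_neq// eq_sym.
Qed.

(** Deletes q first and then p.  The value 0 on the diagonal makes the
    expression antisymmetric in p and q without exception. *)
Definition omit2 k (w : cochain V k) (X : 'I_k.+2 -> V) (p q : 'I_k.+2) : R :=
  if unlift q p is Some i then (-1) ^+ q * omit w (X \o lift q) i else 0.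

Lemma omit2_lift k (w : cochain V k) X q i :
  omit2 w X (lift q i) q = (-1) ^+ q * omit w (X \o lift q) i.
Proof. by rewrite /omit2 liftK. Qed.

Lemma omit2_ext k (w : cochain V k) X Y p q :
  (forall i, i != p -> i != q -> X i = Y i) -> omit2 w X p q = omit2 w Y p q.
Proof.
rewrite /omit2; case: unliftP => // i -> XY; congr (_ * _).
apply: omit_ext => j nji; apply: XY; first by rewrite (inj_eq lift_inj).
by rewrite eq_sym neq_lift.
Qed.

Lemma omit2_perm k (w : cochain V k) (s : 'S_k.+2) X p q :
  antisymmetric_form w ->
  omit2 w (X \o s) p q = (-1) ^+ s * omit2 w X (s p) (s q).
Proof.
move=> wS; have [t st] := perm_fix_lift s q.
case: (unliftP q p) => [i ->|->]; last by rewrite /omit2 !unlift_none mulr0.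
have -> : s (lift q i) = lift (s q) (t i) by rewrite {1}st lift_perm_lift.
rewrite !omit2_lift; have -> : X \o s \o lift q = (X \o lift (s q)) \o t.
  by apply/funext => j; rewrite /= {1}st lift_perm_lift.
by rewrite omit_perm// [LHS]mulrA [RHS]mulrA (sign_fix_lift _ st).
Qed.

Lemma omit2C k (w : cochain V k) X p q :
  antisymmetric_form w -> omit2 w X q p = - omit2 w X p q.
Proof.
move=> wS; have [->|npq] := eqVneq p q.
  by rewrite /omit2 unlift_none oppr0.
have := omit2_perm (tperm p q) X p q wS.
rewrite tpermL tpermR odd_tperm npq expr1 mulN1r => h; rewrite -[LHS]opprK -h.
by congr (- _); apply: omit2_ext => i nip niq; rewrite /= tpermD// eq_sym.
Qed.

(** The indices are those of the last two slots: here the sign is +1, which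
    fixes the orientation of all the other values of [omit2]. *)
Lemma omit2_last k (w : cochain V k) (X : 'I_k.+2 -> V) (p q : 'I_k.+2) :
  p = k.+1 :> nat -> q = k :> nat ->
  omit2 w X p q = w (fun i => X (cast_ord (addn2 k) (lshift 2 i))).
Proof.
move=> pk qk; have -> : p = lift q ord_max.
  by apply/val_inj; rewrite /= /bump pk qk leqnn.
rewrite omit2_lift /omit mulrA qk /= -expr2 sqrr_sign mul1r.
congr w; apply/funext => i /=; congr X; apply/val_inj => /=.
by rewrite qk /bump [(k <= i)%N]leqNgt ltn_ord /= add0n leqNgt ltn_ord.
Qed.

End Omit.

(** * The differential as a sum over ordered pairs *)

Section Differential.
Variables (R : numFieldType) (V : vectType R) (br : {bilinear V -> V -> V}).
Hypothesis br_alt : forall x, br x x = 0.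

Lemma bracketC x y : br x y = - br y x.
Proof.
apply/eqP; rewrite -addr_eq0; apply/eqP; have := br_alt (x + y).
by rewrite linearDl !linearDr/= !br_alt add0r addr0.
Qed.

(** The summand of the differential at the pair (p, q).  It is defined for
    p and q in either order, which turns the sum over p < q into half of a
    sum over all p != q. *)
Definition bracket_term k (w : cochain V k) X p q :=
  omit w (update X p (br (X p) (X q))) q.

(** Exchanging p and q changes the sign of the bracket, and also the sign
    of the form: the bracket moves from slot p to slot q, and the deleted
    slot from q to p. *)
Lemma bracket_termC k (w : cochain V k) X p q :
  ext_power V k w -> p != q -> bracket_term w X p q = bracket_term w X q p.
Proof.
move=> wE npq; have wS := ext_power_antisymmetric wE.
rewrite /bracket_term; set u := br (X p) (X q).
have -> : br (X q) (X p) = - u by rewrite bracketC.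
have -> : omit w (update X q (- u)) p = - omit w (update X q u) p.
  have := @omit_sum _ _ _ w X q p unit (fun=> -1) (fun=> u) wE.1.
  rewrite !big_const !card_unit /= !addr0 scaleN1r mulN1r; apply.
  by rewrite eq_sym.
rewrite -(@omit_transfer _ _ _ _ _ _ q)// update_same; apply: omit_ext => i niq.
by have [->|nip] := eqVneq i p; rewrite ?update_same// !update_neq.
Qed.

Lemma ce_diff_sum k (w : cochain V k) X : ext_power V k w ->
  ce_diff br w X *+ 2 = \sum_q \sum_(p | p != q) bracket_term w X p q.
Proof.
move=> wE; have dE : ce_diff br w X =
    \sum_(q < k.+1) \sum_(p < k.+1 | (p < q)%N) bracket_term w X p q.
  apply: eq_bigr => q _; rewrite [RHS]big_mkcond (bigD1_ord q)//= ltnn add0r.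
  rewrite big_mkcond; apply: eq_bigr => i _ /=.
  have -> : (bump q i < q)%N = (i < q)%N.
    rewrite /bump [RHS]ltnNge; case: (leqP q i) => qi; rewrite ?add0n//.
    by rewrite add1n ltnNge leqW.
  by case: ifP => // _; rewrite /bracket_term /omit (update_comp _ _ _ lift_inj).
rewrite mulr2n {2}dE (exchange_big_dep xpredT)//= dE -big_split /=.
apply: eq_bigr => q _; rewrite [RHS](bigID (fun p : 'I__ => (p < q)%N))/=.
congr (_ + _); first by apply: eq_bigl => p; rewrite neq_ltn; case: ltngtP.
apply: eq_big => [p|p qp]; first by rewrite -leqNgt neq_ltn; case: ltngtP.
by rewrite bracket_termC// neq_ltn qp.
Qed.

Lemma bracket_term_perm k (w : cochain V k) (s : 'S_k.+1) X p q :
  antisymmetric_form w ->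
  bracket_term w (X \o s) p q = (-1) ^+ s * bracket_term w X (s p) (s q).
Proof.
by move=> wS; rewrite /bracket_term -omit_perm// (update_comp _ _ _ perm_inj).
Qed.

Lemma bracket_term_multilinear k (w : cochain V k) p q : p != q ->
  multilinear w -> multilinear (fun X => bracket_term w X p q).
Proof.
move=> npq wL X i a u v; rewrite /bracket_term.
have [->|nip] := eqVneq i p.
  rewrite !update_same ![update (update _ _ _) _ _]updateU.
  by rewrite !update_neq 1?eq_sym// linearPl omit_multilinear.
have [iq|niq] := eqVneq i q.
  move: nip; rewrite iq => nqp.
  rewrite !update_same !(updateC _ _ _ nqp) !omit_update.
  by rewrite !update_neq 1?eq_sym// linearPr omit_multilinear.
by rewrite !(updateC _ _ _ nip) !update_neq 1?eq_sym// omit_multilinear.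
Qed.

(** In the sum over ordered pairs, permuting the arguments permutes the
    pairs and multiplies every summand by the sign of the permutation. *)
Lemma ce_diff_ext_power k (w : cochain V k) :
  ext_power V k w -> ext_power V k.+1 (ce_diff br w).
Proof.
move=> wE; have two_neq0 : 2%:R != 0 :> R by rewrite pnatr_eq0.
apply: antisymmetric_ext_power => [X i a u v|s X]; apply: (mulIf two_neq0).
  rewrite mulrDl -mulrA !mulr_natr !ce_diff_sum// big_distrr -big_split/=.
  apply: eq_bigr => q _; rewrite big_distrr -big_split/=.
  by apply: eq_bigr => p npq; rewrite bracket_term_multilinear//; case: wE.
rewrite -mulrA !mulr_natr !ce_diff_sum// [in RHS](reindex_inj (@perm_inj _ s))/=.
rewrite big_distrr; apply: eq_bigr => q _.
rewrite [in RHS](reindex_inj (@perm_inj _ s))/= big_distrr/=.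
apply: eq_big => p; first by rewrite (inj_eq perm_inj).
by move=> _; rewrite bracket_term_perm//; exact: ext_power_antisymmetric.
Qed.

End Differential.

(** * Products with a 1-form and with a 2-form *)

Section Products.
Variables (R : numFieldType) (V : vectType R).

(** The product alpha /\ w of a 1-form and a k-form, expanded along the
    argument that alpha receives; unlike the sum over permutations, this
    needs no normalizing factor. *)
Definition wedge1 k (alpha : cochain V 1) (w : cochain V k) : cochain V k.+1 :=
  fun X => \sum_i alpha (fun=> X i) * omit w X i.

Lemma wedge1_antisymmetric k alpha (w : cochain V k) :
  antisymmetric_form w -> antisymmetric_form (wedge1 alpha w).
Proof.
move=> wS s X; rewrite /wedge1 [in RHS](reindex_inj (@perm_inj _ s)) big_distrr.
by apply: eq_bigr => i _; rewrite omit_perm//= mulrCA.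
Qed.

Lemma wedge1_ext_power k alpha (w : cochain V k) :
  multilinear alpha -> ext_power V k w -> ext_power V k.+1 (wedge1 alpha w).
Proof.
move=> aL wE; apply: antisymmetric_ext_power; last first.
  exact/wedge1_antisymmetric/ext_power_antisymmetric.
move=> X j c u v; rewrite /wedge1 big_distrr -big_split; apply: eq_bigr => i _.
have [->|nij] := eqVneq i j.
  by rewrite !update_same !omit_update /= cochain1P// mulrDl mulrA.
rewrite !update_neq// omit_multilinear 1?eq_sym//=; last by case: wE.
by rewrite mulrDr [alpha _ * (c * _)]mulrCA.
Qed.

Lemma omit_wedge1 k alpha (w : cochain V k) X q :
  omit (wedge1 alpha w) X q
    = \sum_(l | l != q) alpha (fun=> X l) * omit2 w X l q.
Proof.
rewrite sum_lift /omit /wedge1 big_distrr; apply: eq_bigr => i _ /=.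
by rewrite omit2_lift mulrCA.
Qed.

(** Extend Y by a vector v to a longer free family and take for alpha the
    coordinate along v: the only surviving term of the product deletes v. *)
Lemma wedge1_detects k (w : cochain V k) (Y : 'I_k -> V) :
  (k < \dim {:V})%N -> free [tuple Y i | i < k] ->
  (forall alpha (X : 'I_k.+1 -> V), ext_power V 1 alpha ->
     free [tuple X i | i < k.+1] -> wedge1 alpha w X = 0) ->
  w Y = 0.
Proof.
move=> dimV Yfree w0.
have [v vY] : exists v, v \notin <<[tuple Y i | i < k]>>%VS.
  apply: contraPP (dimV) => h; apply/negP; rewrite -leqNgt.
  have := dim_span [tuple Y i | i < k]; rewrite size_tuple; apply: leq_trans.
  apply/dimvS/subvP => u _; apply: contra_notT h => ?; by exists u.
(* The new vector goes first, where it is deleted with sign +1. *)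
pose X (i : 'I_k.+1) := if unlift ord0 i is Some j then Y j else v.
have XE : [tuple X i | i < k.+1] = v :: [tuple Y i | i < k] :> seq V.
  rewrite /= enum_ordSl /= /X unlift_none -map_comp; congr (_ :: _).
  by apply: eq_map => i /=; rewrite liftK.
have Xfree : free [tuple X i | i < k.+1] by rewrite XE free_cons vY.
set e := [tuple X i | i < k.+1] in Xfree.
have eX (i : 'I_k.+1) : e`_i = X i by rewrite -tnth_nth tnth_mktuple.
have := w0 _ X (linear_ext_power (coord e ord0)) Xfree.
rewrite /wedge1 (bigD1 ord0)//= -[X ord0]eX coord_free// mul1r big1 => [|i ni0].
  rewrite addr0 /omit mul1r => <-; congr w; apply/funext => i.
  by rewrite /X /= liftK.
by rewrite -[X i]eX coord_free// (negbTE ni0) mul0r.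
Qed.

End Products.

Lemma perm_2transitive n (a b p q : 'I_n) : a != b -> p != q ->
  exists t : 'S_n, t a = p /\ t b = q.
Proof.
move=> nab npq; exists (tperm a p * tperm (tperm a p b) q)%g.
rewrite !permM tpermL tpermL; split=> //.
rewrite (@tpermD _ (tperm a p b)) 1?[q == p]eq_sym//.
by rewrite -[X in _ != X](tpermL a p) (inj_eq perm_inj) eq_sym.
Qed.

(** The left-hand sum over permutations does not depend on the pair (a, b),
    the symmetric group being 2-transitive; summing over all n (n - 1)
    pairs, each permutation then contributes the full right-hand sum. *)
Lemma sum_perm_pair (M : zmodType) n (f : 'I_n -> 'I_n -> M) a b : a != b ->
  (\sum_(s : 'S_n) f (s a) (s b)) *+ (n * n.-1)
    = (\sum_q \sum_(p | p != q) f p q) *+ n`!.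
Proof.
move=> nab; pose S a b := \sum_(s : 'S_n) f (s a) (s b).
have SE p q : p != q -> S p q = S a b.
  move=> npq; have [t [<- <-]] := perm_2transitive nab npq.
  rewrite [RHS](reindex_inj (mulgI t)); apply: eq_bigr => s _ /=.
  by rewrite !permM.
have <- : \sum_q \sum_(p | p != q) S p q = S a b *+ (n * n.-1).
  transitivity (\sum_(q < n) S a b *+ n.-1); last first.
    by rewrite sumr_const card_ord -mulrnA mulnC.
  apply: eq_bigr => q _; rewrite (eq_bigr _ (fun p => SE p q)) sumr_const.
  by rewrite cardC1 card_ord.
have -> : n`! = #|{: 'S_n}| by rewrite card_Sn.
rewrite -sumr_const.
under eq_bigr do rewrite exchange_big.
rewrite exchange_big; apply: eq_bigr => s _ /=.
rewrite [RHS](reindex_inj (@perm_inj _ s)); apply: eq_bigr => q _ /=.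
rewrite [RHS](reindex_inj (@perm_inj _ s)); apply: eq_big => //= p.
by rewrite (inj_eq perm_inj).
Qed.

(** The index types of a wedge product, of size k + 2, and of a
    differential, of size k.+2, are equal but not convertible; sums over
    permutations are carried from one to the other by destructing the
    equality for a variable n. *)
Lemma sum_perm_cast (M : nmodType) m n (e : m = n)
    (f : bool -> ('I_m -> 'I_n) -> M) :
  \sum_(s : 'S_m) f s (cast_ord e \o s) = \sum_(s : 'S_n) f s (s \o cast_ord e).
Proof.
case: n / e f => f; apply: eq_bigr => s _.
by congr f; apply/funext => i; rewrite /= !cast_ord_id.
Qed.

Section Wedge2.
Variables (R : numFieldType) (V : vectType R).

Definition pair2 (u v : V) : 'I_2 -> V := fun j => if j == ord0 then u else v.

(** By [omit2_perm] the sign of each permutation s cancels against the one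
    that comes out of w, so that the summand depends only on the values of
    s at the last two slots.  The k! permutations with given values there
    cancel the normalization up to the factor 2 of the left-hand side. *)
Lemma wedge2_sum k (w : cochain V k) (eta : cochain V 2) X :
  antisymmetric_form w ->
  wedge w eta (X \o cast_ord (addn2 k)) *+ 2
    = \sum_q \sum_(p | p != q) omit2 w X p q * eta (pair2 (X q) (X p)).
Proof.
move=> wS; set T := RHS.
pose f p q := omit2 w X p q * eta (pair2 (X q) (X p)).
pose p0 : 'I_k.+2 := cast_ord (addn2 k) (rshift k ord_max).
pose q0 : 'I_k.+2 := cast_ord (addn2 k) (rshift k ord0).
have p0k : p0 = k.+1 :> nat by rewrite /= addn1.
have q0k : q0 = k :> nat by rewrite /= addn0.
have wE : wedge w eta (X \o cast_ord (addn2 k)) =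
    ((k`! * 2`!)%:R)^-1 * \sum_(s : 'S_k.+2) f (s p0) (s q0).
  congr (_ * _).
  rewrite (sum_perm_cast (addn2 k) (fun b g => (-1) ^+ b *
    w (fun i => X (g (lshift 2 i))) * eta (fun j => X (g (rshift k j))))).
  apply: eq_bigr => s _; rewrite -(omit2_last w (X \o s) p0k q0k) omit2_perm//.
  rewrite mulrA -signr_addb addbb mul1r; congr (_ * eta _).
  apply/funext => -[[|[]]]//= ltj; rewrite /pair2 /=;
  by congr (X (s _)); apply/val_inj.
have npq : p0 != q0 by rewrite -val_eqE /= addn0 addn1 gtn_eqF.
have nz j : (0 < j)%N -> j%:R != 0 :> R by rewrite pnatr_eq0 -lt0n.
have ST : \sum_(s : 'S_k.+2) f (s p0) (s q0) = T * k`!%:R.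
  have N0 : (k.+2 * k.+1)%:R != 0 :> R by exact: nz.
  have /= SE := sum_perm_pair f npq.
  apply: (mulIf N0); rewrite [LHS]mulr_natr SE -/T -mulrA -natrM.
  by rewrite mulr_natr; congr (_ *+ _); rewrite !factS mulnA mulnC.
have kf0 := nz _ (fact_gt0 k); have two0 := nz 2%N isT.
rewrite wE ST -[LHS]mulr_natr (_ : 2`! = 2%N)// natrM invfM mulrC mulrA.
by rewrite [2 * _]mulrCA mulfV// mulr1 mulrC mulfK.
Qed.

Lemma ce_diff1_pair (br : {bilinear V -> V -> V}) (alpha : cochain V 1) u v :
  ce_diff br alpha (pair2 u v) = - alpha (fun=> br u v).
Proof. by rewrite ce_diff1E. Qed.

End Wedge2.

(** * Leibniz rule and unimodularity *)

(** Conjugating by the change of basis does not change the trace. *)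
Lemma lfun_traceE (R : fieldType) (V : vectType R) n (e : n.-tuple V)
    (f : 'End(V)) :
  basis_of fullv e -> lfun_trace f = \sum_i coord e i (f e`_i).
Proof.
move=> eB; have nE := size_basis eB; case: n / nE e eB => e eB.
have bB := vbasisP (@fullv _ V); set b := vbasis _ in bB.
have bfE : passmx.mxof b b f =
    passmx.mxof b e \1 *m passmx.mxof e e f *m passmx.mxof e b \1.
  by rewrite -!passmx.mxof_comp// comp_lfun1r comp_lfun1l.
rewrite /lfun_trace bfE -mulmxA mxtrace_mulC -mulmxA -passmx.mxof_comp//.
rewrite comp_lfun1r passmx.mxof1 ?(basis_free eB)// mulmx1.
by apply: eq_bigr => i _; rewrite !mxE /= passmx.vecof_delta.
Qed.

Lemma free_basis (R : fieldType) (V : vectType R) n (X : n.-tuple V) :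
  \dim {:V} = n -> free X -> basis_of fullv X.
Proof. by move=> dimV Xf; rewrite basisEfree Xf subvf dimV size_tuple leqnn. Qed.

Lemma free_tuple_cast (R : fieldType) (V : vectType R) m n (e : m = n)
    (X : 'I_n -> V) :
  free [tuple (X \o cast_ord e) i | i < m] = free [tuple X i | i < n].
Proof.
case: n / e X => X; congr (free _); apply: eq_map => i.
by rewrite /= cast_ord_id.
Qed.

Section TopDegree.
Variables (R : numFieldType) (V : vectType R) (br : {bilinear V -> V -> V}).
Hypothesis br_alt : forall x, br x x = 0.

Lemma omit_bracket_term k (w : cochain V k) (X : 'I_k.+2 -> V)
    (l : 'I_k.+2) p q :
  (-1) ^+ l * bracket_term br w (X \o lift l) p q =
  omit2 w (update X (lift l p) (br (X (lift l p)) (X (lift l q)))) (lift l q) l.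
Proof. by rewrite omit2_lift (update_comp _ _ _ lift_inj). Qed.

(** d(alpha /\ w) = d alpha /\ w - alpha /\ d w, where w /\ d alpha stands
    for d alpha /\ w because a 2-form commutes with everything.  Expanding
    the left side gives a bracket [X p, X q] in slot p, a deleted slot q
    and a slot l fed to alpha.  The terms with l = p feed the bracket to
    alpha and make up d alpha /\ w; the others make up alpha /\ d w. *)
Lemma leibniz k alpha (w : cochain V k) X :
  ext_power V 1 alpha -> ext_power V k w ->
  ce_diff br (wedge1 alpha w) X
    = wedge w (ce_diff br alpha) (X \o cast_ord (addn2 k))
      - wedge1 alpha (ce_diff br w) X.
Proof.
move=> [aL _] wE; have wS := ext_power_antisymmetric wE.
have two_neq0 : 2%:R != 0 :> R by rewrite pnatr_eq0.
apply: (mulIf two_neq0); rewrite mulrBl !mulr_natr wedge2_sum//.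
rewrite ce_diff_sum//; last exact: wedge1_ext_power.
pose Xpq (p q : 'I_k.+2) := update X p (br (X p) (X q)).
have -> : wedge1 alpha (ce_diff br w) X *+ 2 = \sum_(l < k.+2) \sum_(q | q != l)
    \sum_(p | (p != l) && (p != q)) alpha (fun=> X l) * omit2 w (Xpq p q) q l.
  rewrite -sumrMnl; apply: eq_bigr => l _.
  rewrite -mulrnAr /omit -mulrnAr ce_diff_sum// sum_lift !big_distrr.
  apply: eq_bigr => q _ /=; rewrite !big_distrr /=.
  rewrite [RHS](eq_bigl (fun p => (p != l) && (p != lift l q)))//.
  rewrite [RHS]big_mkcondr [RHS]sum_lift [LHS]big_mkcond.
  apply: eq_bigr => p _ /=.
  by rewrite (inj_eq lift_inj) omit_bracket_term.
have -> : \sum_(l < k.+2) \sum_(q | q != l) \sum_(p | (p != l) && (p != q))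
      alpha (fun=> X l) * omit2 w (Xpq p q) q l
    = \sum_q \sum_(p | p != q) \sum_(l | (l != q) && (l != p))
      alpha (fun=> X l) * omit2 w (Xpq p q) q l.
  rewrite (exchange_big_dep xpredT)//=; apply: eq_bigr => q _.
  rewrite (exchange_big_dep (fun p => p != q))/=; last by move=> ? ? _ /andP[].
  apply: eq_bigr => p npq; apply: eq_bigl => l.
  by rewrite npq andbT eq_sym [p == l]eq_sym.
(* All three sums now run over the pairs p != q and can be compared for
   fixed p and q; on the left, the term l = p is separated from the others. *)
rewrite -sumrB; apply: eq_bigr => q _; rewrite -sumrB; apply: eq_bigr => p npq.
rewrite /bracket_term omit_wedge1 (bigD1 p)//= update_same; congr (_ + _).
  rewrite ce_diff1_pair (bracketC br_alt (X q)) cochain1N// opprK mulrC.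
  by congr (_ * _); apply: omit2_ext => i nip niq; rewrite update_neq.
rewrite -sumrN; apply: eq_bigr => l /andP[nlq nlp].
by rewrite update_neq// omit2C// mulrN.
Qed.

(** A nonzero form of top degree is never exact on a unimodular algebra:
    expand the bracket [X p, X q] on the basis X.  In slot p with slot q
    deleted, only the coefficients at X p and at X q survive, and summing
    them over p, respectively over q, yields the traces of ad (X q) and of
    ad (X p). *)
Lemma ce_diff_codim1 k (theta : cochain V k) (X : 'I_k.+1 -> V) :
  \dim {:V} = k.+1 -> unimodular br -> ext_power V k theta ->
  free [tuple X i | i < k.+1] -> ce_diff br theta X = 0.
Proof.
move=> dimV br_uni thE Xfree; have thS := ext_power_antisymmetric thE.
have [thL thA] := thE.
set e := [tuple X i | i < k.+1] in Xfree.
have eB := free_basis dimV Xfree.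
have eX (i : 'I_k.+1) : e`_i = X i by rewrite -tnth_nth tnth_mktuple.
pose c p q r := coord e r (br (X p) (X q)).
have brE p q : br (X p) (X q) = \sum_r c p q r *: X r.
  rewrite [LHS](coord_basis eB (memvf _)); apply: eq_bigr => r _.
  by rewrite eX.
(* The diagonal coefficient at q = p vanishes as [X p, X p] = 0, so that
   leaving it out does not change the trace of ad (X p). *)
have c_tr p : \sum_(q | q != p) c p q q = 0.
  rewrite -[RHS](br_uni (X p)) (lfun_traceE _ eB) [RHS](bigD1 p)//=.
  rewrite lfunE/= eX br_alt linear0 add0r.
  by apply: eq_bigr => q _; rewrite lfunE/= eX.
have cC p q r : c p q r = - c q p r.
  by rewrite /c (bracketC br_alt (X p)) linearN.
have termE p q : p != q -> bracket_term br theta X p q =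
    c p q p * omit theta X q - c p q q * omit theta X p.
  move=> npq; rewrite /bracket_term brE omit_sum//.
  rewrite (bigD1 p)//= (bigD1 q) 1?eq_sym//=.
  rewrite update_id omit_transfer// mulrN big1 ?addr0// => r /andP[nrp nrq].
  rewrite (omit_repeat thA nrp nrq npq) ?mulr0//.
  by rewrite update_same update_neq.
have two_neq0 : 2%:R != 0 :> R by rewrite pnatr_eq0.
apply: (mulIf two_neq0); rewrite mul0r mulr_natr ce_diff_sum//.
under eq_bigr do under eq_bigr do rewrite termE//.
under eq_bigr do rewrite sumrB.
rewrite sumrB [X in X - _]big1 => [|q _].
  rewrite sub0r (exchange_big_dep xpredT)//= big1 ?oppr0// => p _.
  under eq_bigl do rewrite eq_sym.
  by rewrite -mulr_suml c_tr mul0r.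
rewrite -mulr_suml; under eq_bigr do rewrite cC.
by rewrite sumrN c_tr oppr0 mul0r.
Qed.

(** In codimension 2, the form alpha /\ w has codimension 1, so the Leibniz
    rule loses its left-hand side. *)
Lemma wedge_ce_diff k alpha (w : cochain V k) (X : 'I_k.+2 -> V) :
  \dim {:V} = k.+2 -> unimodular br ->
  ext_power V 1 alpha -> ext_power V k w -> free [tuple X i | i < k.+2] ->
  wedge w (ce_diff br alpha) (X \o cast_ord (addn2 k))
    = wedge1 alpha (ce_diff br w) X.
Proof.
move=> dimV br_uni aE wE Xfree; apply/eqP; rewrite -subr_eq0 -leibniz//.
by rewrite ce_diff_codim1//; apply: wedge1_ext_power; case: aE.
Qed.

(** On bases, w /\ d alpha and alpha /\ dw agree by [wedge_ce_diff]; on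
    dependent tuples both dw and w /\ d alpha vanish. *)
Lemma closed_iff_wedge_exact0 k (w : cochain V k) :
  \dim {:V} = k.+2 -> unimodular br -> ext_power V k w ->
  ce_diff br w = 0 <->
  forall alpha, ext_power V 1 alpha -> wedge w (ce_diff br alpha) = 0.
Proof.
move=> dimV br_uni wE; have dwE := ce_diff_ext_power br_alt wE.
split=> [dw0 alpha aE|w0].
  apply/funext => X; pose X' := X \o cast_ord (esym (addn2 k)).
  have XE : X = X' \o cast_ord (addn2 k).
    by apply/funext => i; rewrite /X' /= cast_ordK.
  have [Xfree|Xdep] := boolP (free [tuple X' i | i < k.+2]).
    rewrite XE wedge_ce_diff// dw0 /wedge1 big1// => i _.
    by rewrite /omit mulr0 mulr0.
  have daE := ce_diff_ext_power br_alt aE.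
  apply: ext_power_dependent.
    by apply: wedge_ext_power; [case: wE|case: daE].
  by rewrite XE free_tuple_cast.
apply/funext => Y; have [Yfree|] := boolP (free [tuple Y i | i < k.+1]).
  apply: wedge1_detects => // [|alpha X aE Xfree]; first by rewrite dimV.
  by rewrite -wedge_ce_diff// w0.
exact: ext_power_dependent.
Qed.

End TopDegree.

(** * Abelian balanced Hermitian structures *)

Lemma fundamental_form_multilinear (R : realType) (V : vectType R)
    (J : {linear V -> V}) (g : {dot V for idfun}) :
  multilinear (fundamental_form J g).
Proof.
move=> X i a u v; rewrite /fundamental_form /update.
have [->|] := eqVneq i ord0; first by rewrite /= linearPl.
case: i => [[|[]]]//= i2 _; rewrite /eq_op /=.
by rewrite linearP linearPr.
Qed.

(** d alpha (X, Y) = - alpha [X, Y], and 1-forms separate vectors. *)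
Lemma abelian_iff_pullback (R : numFieldType) (V : vectType R)
    (br : {bilinear V -> V -> V}) (J : V -> V) :
  is_abelian br J <->
  forall alpha, ext_power V 1 alpha ->
    pullback J (ce_diff br alpha) = ce_diff br alpha.
Proof.
split=> [abJ alpha _|dJ x y].
  by apply/funext => X; rewrite /pullback !ce_diff1E /= abJ.
apply/eqP; rewrite -subr_eq0; apply/eqP; apply: ext_power1_separates.
move=> alpha aE.
rewrite addrC -scaleN1r cochain1P ?mulN1r; last by case: aE.
have := congr1 (@^~ (pair2 x y)) (dJ _ aE); rewrite /pullback !ce_diff1E /=.
by move/oppr_inj => ->; rewrite addNr.
Qed.

Theorem corollary2p6 (R : realType) (n : nat) (V : vectType R)
    (br : {bilinear V -> V -> V}) (J : {linear V -> V}) (g : {dot V for idfun})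
    (dimV : \dim {:V} = (2 * n)%N)
    (br_lie : is_lie_bracket br)
    (br_unimodular : unimodular br)
    (Jg_hermitian : is_hermitian_structure br J g) :
  is_abelian_balanced br n J g <->
  [set ce_diff br alpha | alpha in ext_power V 1] `<=` Gamma n J g.
Proof.
have br_alt := lie_bracket_alt br_lie.
set F := fundamental_form J g.
have wE : ext_power V n.-1.*2 (wedge_pow F n.-1).
  exact/wedge_pow_ext_power/fundamental_form_multilinear.
have balancedE : is_balanced br n F <-> forall alpha, ext_power V 1 alpha ->
    wedge (wedge_pow F n.-1) (ce_diff br alpha) = 0.
  (* For n = 0, V = 0 and n.-1 = 0: both sides hold as V has no nonzero
     forms of positive degree. *)
  case: n dimV wE => [|n] dimV wE; last first.
    by apply: closed_iff_wedge_exact0; rewrite // dimV mul2n.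
  split=> [_ alpha aE|_]; apply: ext_power_gt_dim; rewrite ?dimV//.
    have daE := ce_diff_ext_power br_alt aE.
    by apply: wedge_ext_power; [case: wE|case: daE].
  exact: ce_diff_ext_power.
rewrite /is_abelian_balanced abelian_iff_pullback balancedE; split.
  move=> [inv bal] _ [alpha aE <-]; split; last exact: bal.
    exact: ce_diff_ext_power.
  exact: inv.
move=> dG; split=> alpha aE; by have [] := dG _ (ex_intro2 _ _ alpha aE erefl).
Qed.
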